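(* Let $q$ be generic, and let $X$ and $Y$ be the operators on $M_N$ with parameters $\alpha,\beta$ defined in the context. The normalized solutions $U_n$, $n=0,1,\dots,N$, of the generalized eigenvalue problem $$YU_n=\lambda_n XU_n$$ are given by $$U_n(x;\alpha,\beta,N;q)=\frac{(q^{-N};q)_n}{(q^{-n-\beta};q)_n}\;{}_3\phi_2\!\left(\begin{matrix}q^{-n},\;q^{n+\beta-N},\;q^{-x}\\ q^{-N},\;q^{\alpha-x}\end{matrix};\,q;\,q^{\alpha-\beta}\right),$$ with the spectrum $\lambda_n$ given by $$\lambda_n=[-n]_q\,[n+\beta-N]_q .$$ The functions $U_n$ are called ''biorthogonal rational functions of the $q$-Hahn type''.
   Context: Notation: $[y]_q=\frac{1-q^y}{1-q}$ are the $q$-numbers and $(a;q)_k=(1-a)(1-qa)\cdots(1-q^{k-1}a)$ is the $q$-Pochhammer symbol (with $(a;q)_0=1$). The basic hypergeometric series is $${}_{r+1}\phi_r\!\left(\begin{matrix}a_0,a_1,\dots,a_r\\ b_1,\dots,b_r\end{matrix};\,q;\,z\right)=\sum_{k=0}^{\infty}\frac{(a_0;q)_k(a_1;q)_k\cdots(a_r;q)_k}{(q;q)_k(b_1;q)_k\cdots(b_r;q)_k}\,z^k .$$ For the series in the claim, which has the numerator parameter $q^{-n}$, the sum runs over $k=0,\dots,n$. $M_N$ is the $(N+1)$-dimensional space of real functions $f(x)$ defined on the finite set of points $x=0,1,\dots,N$. The operators $X$ and $Y$, which depend on the parameters $\alpha,\beta$, are $$(Xf)(x)=[x-\alpha]_q\,f(x)-q^{-\alpha}[x]_q\,f(x-1),$$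 $$(Yf)(x)=A_1(x)f(x+1)+A_2(x)f(x-1)+A_0(x)f(x),$$ where $$A_1(x)=q^{\beta-x}[x-N]_q[x+1-\alpha]_q[x-\alpha]_q,$$ $$A_2(x)=q^{-x}[x]_q[x-N-\alpha+\beta]_q[x-\alpha]_q,$$ $$A_0(x)=-(A_1(x)+A_2(x)).$$ On $M_N$ the terms involving $f(-1)$ and $f(N+1)$ are absent, since their coefficients vanish ($[x]_q=0$ at $x=0$ and $[x-N]_q=0$ at $x=N$). ''Normalized'' means that the multiplicative constant in $U_n$ has been chosen so that $\lim_{x\to\infty}U_n=1$.
   Formalization: q is real, q>0, q≠1; α is not in {0,…,N} and β is not in {-N,…,-1}, so that the problem and U_n are well defined; the normalization U_n→1 as x→∞ is claimed for q<1 only, since it fails for q>1, where the limit is taken as x→-∞ instead. *)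

(* Defs.v *)
From mathcomp Require Import all_boot all_order all_algebra.
From mathcomp Require Import all_classical all_reals all_analysis.

Set Implicit Arguments.
Unset Strict Implicit.
Unset Printing Implicit Defensive.

Import Order.TTheory GRing.Theory Num.Theory numFieldNormedType.Exports.
Local Open Scope ring_scope.

Section QHahn.
Context {R : realType}.
Implicit Types (q a x y z alpha beta : R) (n k N : nat).

Definition qnum q y : R := (1 - q `^ y) / (1 - q).

Definition qpoch q a k : R := \prod_(i < k) (1 - q ^+ i * a).

(* Partial sum over 0 <= k <= n of the basic hypergeometric series with
   numerator parameters [num] and denominator parameters [den] (one fewer).
   It is the whole series when q^{-n} is one of the numerator parameters. *)
Definition qhyp n (num den : seq R) q z : R :=
  \sum_(k < n.+1)
    (\prod_(a <- num) qpoch q a k)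
      / (qpoch q q k * \prod_(b <- den) qpoch q b k) * z ^+ k.

(* Value at the integer y of f in M_N, extended by 0 outside {0, ..., N}; the
   extension only occurs below multiplied by a vanishing coefficient. *)
Definition ext0 N (f : {ffun 'I_N.+1 -> R}) (y : int) : R :=
  \sum_(i : 'I_N.+1 | (i : nat)%:Z == y) f i.

Definition A1 q alpha beta N x : R :=
  q `^ (beta - x) * qnum q (x - N%:R) * qnum q (x + 1 - alpha)
    * qnum q (x - alpha).

Definition A2 q alpha beta N x : R :=
  q `^ (- x) * qnum q x * qnum q (x - N%:R - alpha + beta)
    * qnum q (x - alpha).

Definition A0 q alpha beta N x : R :=
  - (A1 q alpha beta N x + A2 q alpha beta N x).

Definition opX q alpha N (f : {ffun 'I_N.+1 -> R}) : {ffun 'I_N.+1 -> R} :=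
  [ffun i : 'I_N.+1 => let x : R := (i : nat)%:R in
     qnum q (x - alpha) * f i
     - q `^ (- alpha) * qnum q x * ext0 f ((i : nat)%:Z - 1)].

Definition opY q alpha beta N (f : {ffun 'I_N.+1 -> R}) :
    {ffun 'I_N.+1 -> R} :=
  [ffun i : 'I_N.+1 => let x : R := (i : nat)%:R in
     A1 q alpha beta N x * ext0 f ((i : nat)%:Z + 1)
     + A2 q alpha beta N x * ext0 f ((i : nat)%:Z - 1)
     + A0 q alpha beta N x * f i].

(* A function of a real variable; its poles, where a denominator vanishes and
   division returns 0, form a finite set. *)
Definition qHahnU n x alpha beta N q : R :=
  qpoch q (q `^ (- N%:R)) n / qpoch q (q `^ (- n%:R - beta)) n
  * qhyp n
      [:: q `^ (- n%:R); q `^ (n%:R + beta - N%:R); q `^ (- x)]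
      [:: q `^ (- N%:R); q `^ (alpha - x)]
      q (q `^ (alpha - beta)).

Definition restrict_grid N (u : R -> R) : {ffun 'I_N.+1 -> R} :=
  [ffun i : 'I_N.+1 => u (i : nat)%:R].

Definition qHahn_lambda n beta N q : R :=
  qnum q (- n%:R) * qnum q (n%:R + beta - N%:R).

End QHahn.

(* Main.v *)
Require Import Defs.
From HB Require Import structures.
From mathcomp Require Import all_boot all_order all_algebra.
From mathcomp Require Import all_classical all_reals all_analysis.
From mathcomp Require Import ring lra zify.
Import Order.TTheory GRing.Theory Num.Theory numFieldNormedType.Exports.
Local Open Scope classical_set_scope.
Local Open Scope ring_scope.

(* On the grid the functions phi_k(x) = (q^-x; q)_k / (q^(alpha-x); q)_k form a
   triangular basis, X phi_k is a nonzero multiple of the function psi_k got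
   from phi_k by shifting alpha to alpha + 1, and
     Y phi_(k+1) = lambda_(k+1) X phi_(k+1) + nu_k X phi_k,   Y phi_0 = 0,
   with nu_k != 0 for k < N and nu_N = 0.  The pencil is thus bidiagonal: its
   eigenvalues are the lambda_k, coinciding ones included, and the coefficients
   of an eigenvector obey a first-order recursion started at k = 0, which is
   the recursion of the coefficients of U_n.  As q^x -> 0, phi_k tends to
   q^(- alpha k), and U_n to a terminating 2phi1 summed by q-Chu-Vandermonde. *)

(** * Triangular systems of functions on the grid *)

Section Triangular.
Context {R : realType} (N : nat) (F : nat -> R -> R).
Context (F_trig : forall i k, (i < k)%N -> F k i%:R = 0).
Context (F_diag : forall i, (i <= N)%N -> F i i%:R != 0).

(** Collocation matrix of the F k at the grid points, lower triangular with nonzero diagonal. *)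
Let A : 'M[R]_N.+1 := \matrix_(i, k) F k (i : nat)%:R.

Let A_unit : A \in unitmx.
Proof.
rewrite unitmxE unitfE det_trig; last first.
  by apply/is_trig_mxP => i k ik; rewrite mxE F_trig.
by apply/prodf_neq0 => i _; rewrite mxE F_diag // -ltnS.
Qed.

Let A_comb (g : nat -> R) (i : 'I_N.+1) :
  (\sum_(k < N.+1) g k *: restrict_grid N (F k)) i
    = (A *m \col_k g (k : nat)) i 0.
Proof.
rewrite sum_ffunE mxE; apply: eq_bigr => k _.
by rewrite !ffunE !mxE mulrC.
Qed.

Lemma triangular_span (f : {ffun 'I_N.+1 -> R}) :
  exists g : nat -> R, f = \sum_(k < N.+1) g k *: restrict_grid N (F k).
Proof.
pose v := invmx A *m \col_i f i.
pose g k := v (inord k) 0; exists g; apply/ffunP => i; rewrite A_comb.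
rewrite (_ : \col_k _ = v); first by rewrite mulKVmx // mxE.
by apply/matrixP => k j; rewrite mxE /g inord_val ord1.
Qed.

Lemma triangular_free (g : nat -> R) :
  \sum_(k < N.+1) g k *: restrict_grid N (F k) = 0 ->
  forall k, (k <= N)%N -> g k = 0.
Proof.
move=> g0 k kN.
have Ag : A *m (\col_j g (j : nat)) = 0.
  by apply/matrixP => i j; rewrite ord1 -A_comb g0 ffunE mxE.
have := congr1 (mulmx (invmx A)) Ag; rewrite mulKmx // mulmx0.
by move/matrixP/(_ (Ordinal (kN : (k < N.+1)%N)) 0); rewrite !mxE.
Qed.

End Triangular.

(** * q-Pochhammer symbols and the q-Chu-Vandermonde sum *)

Section QPochhammer.
Context {R : realType}.
Implicit Types (q a b c : R) (k n : nat).

Lemma qpoch0 q a : qpoch q a 0 = 1.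
Proof. by rewrite /qpoch big_ord0. Qed.

Lemma qpochS q a k : qpoch q a k.+1 = qpoch q a k * (1 - q ^+ k * a).
Proof. by rewrite /qpoch big_ord_recr. Qed.

Lemma qpochSl q a k : qpoch q a k.+1 = (1 - a) * qpoch q (q * a) k.
Proof.
rewrite /qpoch big_ord_recl expr0 mul1r; congr (_ * _).
by apply: eq_bigr => i _; rewrite lift0 exprSr mulrA.
Qed.

Lemma qpoch_shift q a k :
  (1 - a) * qpoch q (q * a) k = qpoch q a k * (1 - q ^+ k * a).
Proof. by rewrite -qpochSl qpochS. Qed.

Lemma qpoch_neq0 q a k :
  (forall i, (i < k)%N -> q ^+ i * a != 1) -> qpoch q a k != 0.
Proof.
move=> h; apply/prodf_neq0 => i _.
by rewrite subr_eq0 eq_sym h.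
Qed.

Lemma qpoch_eq0 q a i k : (i < k)%N -> q ^+ i * a = 1 -> qpoch q a k = 0.
Proof.
move=> ik h; apply/eqP/prodf_eq0.
by exists (Ordinal ik) => //=; rewrite h subrr.
Qed.

(* [P q n k] is [q^(n k) (q^-n; q)_k]; in this form the q-WZ certificate used in
   [telescope] has no pole at [k = n + 1]. *)
Let P q n k : R := \prod_(i < k) (q ^+ n - q ^+ i).

Let PS q n k : P q n k.+1 = P q n k * (q ^+ n - q ^+ k).
Proof. by rewrite /P big_ord_recr. Qed.

(** After the first factor, q^(n+1) - q^(i+1) = q (q^n - q^i). *)
Let PSS q n k : P q n.+1 k.+1 = q ^+ k * (q ^+ n.+1 - 1) * P q n k.
Proof.
elim: k => [|k IH]; first by rewrite PS /P !big_ord0; ring.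
by rewrite PS IH PS !exprS; ring.
Qed.

(** [P q n k * w q b c k] is the k-th term of 2phi1(q^-n, b; c; q; c q^n / b); all dependence on n
    sits in [P]. *)
Let w q b c k : R :=
  qpoch q b k / (qpoch q q k * qpoch q c k) * (c / b) ^+ k.

Let wS q b c k :
  w q b c k.+1 = w q b c k * ((1 - q ^+ k * b) * (c / b))
     / ((1 - q ^+ k.+1) * (1 - q ^+ k * c)).
Proof.
by rewrite /w !qpochS !exprSr !invfM; ring.
Qed.

(** The right-hand side is the q-WZ certificate. At m = n + 1 it leaves (1 - q^n c) S_(n+1) = (1 -
    q^n c / b) S_n for the sums S_n of the 2phi1. *)
Let telescope q b c n m : b != 0 ->
  (forall k, (k < m)%N -> 1 - q ^+ k.+1 != 0 /\ 1 - q ^+ k * c != 0) ->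
  \sum_(k < m.+1) ((1 - q ^+ n * c) * (P q n.+1 k * w q b c k)
        - (1 - q ^+ n * (c / b)) * (P q n k * w q b c k))
  = q ^+ n * (c / b) * (1 - q ^+ m * b) * (P q n m * w q b c m).
Proof.
move=> b0; elim: m => [|m IH] h.
  rewrite big_ord_recl big_ord0 /P !big_ord0 /w !qpoch0 !expr0.
  by field.
rewrite big_ord_recr /= IH; last by move=> k km; apply: h; lia.
have [h1 h2] := h m (ltnSn m).
rewrite PSS PS wS !exprS; rewrite exprS in h1.
by field; rewrite b0 h1 h2.
Qed.

Lemma qChu_Vandermonde q b c n : q != 0 -> b != 0 ->
  (forall k, (k < n)%N -> 1 - q ^+ k.+1 != 0 /\ 1 - q ^+ k * c != 0) ->
  qhyp n [:: q ^- n; b] [:: c] q (c * q ^+ n / b)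
    = qpoch q (c / b) n / qpoch q c n.
Proof.
move=> q0 b0 h.
have -> : qhyp n [:: q ^- n; b] [:: c] q (c * q ^+ n / b)
    = \sum_(k < n.+1) P q n k * w q b c k.
  rewrite /qhyp; apply: eq_bigr => k _.
  rewrite !big_cons !big_nil !mulr1 /w.
  rewrite (_ : c * q ^+ n / b = q ^+ n * (c / b)) ?exprMn; last by ring.
  have -> : P q n k = qpoch q (q ^- n) k * (q ^+ n) ^+ k.
    elim: (k : nat) => [|i IH]; first by rewrite /P qpoch0 big_ord0 mulr1.
    by rewrite PS IH qpochS exprSr; field; apply: expf_neq0.
  by ring.
elim: n h => [|n IH] h.
  by rewrite big_ord_recl big_ord0 /P big_ord0 /w !qpoch0; field.
have [h1 h2] := h n (ltnSn n).
(* The range reaches n + 1 to contain all of S_(n+1); the extra term of S_n and the boundary term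
   both carry [P q n n.+1], which is 0. *)
have := telescope q b c n n.+1 b0 h.
rewrite PS subrr mulr0 mul0r mulr0 sumrB -!mulr_sumr.
rewrite [X in _ - _ * X]big_ord_recr /= PS subrr mulr0 mul0r addr0.
rewrite IH; last by move=> k kn; apply: h; lia.
move/eqP; rewrite subr_eq0 => /eqP e.
apply: (mulfI h2); rewrite e !qpochS.
have : qpoch q c n != 0.
  apply: qpoch_neq0 => i /ltnW hi.
  by have [_] := h i hi; rewrite subr_eq0 eq_sym.
by move=> h3; field; rewrite b0 h2 h3.
Qed.

End QPochhammer.

(** * Powers of q with real exponents *)

Section Grid.
Context {R : realType}.
Context (N : nat) (q alpha beta : R).
Context (q_gt0 : 0 < q) (q_neq1 : q != 1).
Context (halpha : forall j : nat, (j <= N)%N -> alpha != j%:R).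
Implicit Types (i k n : nat) (f g : {ffun 'I_N.+1 -> R}).

Let q_neq0 : q != 0. Proof. exact: lt0r_neq0. Qed.
Let q1_neq0 : 1 - q != 0. Proof. by rewrite subr_eq0 eq_sym. Qed.
Let qpow_neq0 n : q ^+ n != 0. Proof. exact: expf_neq0. Qed.
Let qpowR_neq0 (x : R) : q `^ x != 0.
Proof. exact/lt0r_neq0/powR_gt0. Qed.

Let qpowRD (x y : R) : q `^ (x + y) = q `^ x * q `^ y.
Proof. by rewrite powRD // q_neq0 implybT. Qed.

Let qpown n : q `^ n%:R = q ^+ n.
Proof. by rewrite powR_mulrn // ltW. Qed.

Let qpow_eq1 n : (q ^+ n == 1) = (n == 0)%N.
Proof.
by rewrite -qpown powR_eq1 (negbTE q_neq1) ltNge (ltW q_gt0) /= pnatr_eq0.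
Qed.

Let qpowRnat n (x : R) : q ^+ n * q `^ x = q `^ (n%:R + x).
Proof. by rewrite qpowRD qpown. Qed.

Let qpow_sub1_neq0 n : (0 < n)%N -> 1 - q ^+ n != 0.
Proof. by case: n => // n _; rewrite subr_eq0 eq_sym qpow_eq1. Qed.

Let qpowR_eq1 (x : R) : (q `^ x == 1) = (x == 0).
Proof. by rewrite powR_eq1 (negbTE q_neq1) ltNge (ltW q_gt0). Qed.

Lemma qnum0 : qnum q 0 = 0.
Proof. by rewrite /qnum powRr0 subrr mul0r. Qed.

(** * The functions phi_k ([a] = alpha) and psi_k ([a] = alpha + 1) on the grid *)

Definition qphi (a : R) k (x : R) : R :=
  qpoch q (q `^ (- x)) k / qpoch q (q `^ (a - x)) k.

(** Superdiagonal entries of the pencil; the factor 1 - q^(k-N) makes it close up on M_N. *)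
Definition qHahn_nu k : R :=
  q `^ beta / (q `^ alpha * q ^+ k) * (1 - q ^+ k / q ^+ N) * (1 - q ^+ k.+1)
    / (1 - q) ^+ 2.

Lemma qpoch_grid0 i k : (i < k)%N -> qpoch q (q `^ (- i%:R)) k = 0.
Proof.
by move=> ik; apply: (@qpoch_eq0 _ _ _ i) => //; rewrite qpowRnat subrr powRr0.
Qed.

(* The denominator may vanish too; the junk value 0 / 0 = 0 is the right one. *)
Lemma qphi_grid0 a i k : (i < k)%N -> qphi a k i%:R = 0.
Proof. by move=> ik; rewrite /qphi qpoch_grid0 // mul0r. Qed.

(** A zero factor of index j < k would give alpha = i - j in {0, ..., N}, against [halpha]. *)
Lemma qpoch_den_neq0 i k : (k <= i.+1)%N -> (i <= N)%N ->
  qpoch q (q `^ (alpha - i%:R)) k != 0.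
Proof.
move=> ki iN; apply: qpoch_neq0 => j jk; rewrite qpowRnat qpowR_eq1.
have ji : (j <= i)%N by lia.
have := halpha (i - j)%N; rewrite natrB // => /(_ ltac:(lia)).
by apply: contra_neq => e; lra.
Qed.

(** The bound drops to k <= i: the next factor is 1 - q^(alpha+1), which is 0 at alpha = -1. *)
Lemma qpoch_den1_neq0 i k : (k <= i)%N -> (i <= N)%N ->
  qpoch q (q `^ (alpha + 1 - i%:R)) k != 0.
Proof.
case: i => [|i] ki iN.
  by move: ki; rewrite leqn0 => /eqP ->; rewrite qpoch0 oner_neq0.
have -> : alpha + 1 - i.+1%:R = alpha - i%:R by rewrite -natr1; ring.
by apply: qpoch_den_neq0; lia.
Qed.

Lemma qphi_diag_neq0 i : (i <= N)%N -> qphi alpha i i%:R != 0.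
Proof.
move=> iN; apply: mulf_neq0; last by rewrite invr_eq0 qpoch_den_neq0.
apply: qpoch_neq0 => j ji; rewrite qpowRnat qpowR_eq1 subr_eq0 eqr_nat.
by rewrite neq_ltn ji.
Qed.

Lemma qphi1_diag_neq0 i : (i <= N)%N -> qphi (alpha + 1) i i%:R != 0.
Proof.
move=> iN; apply: mulf_neq0; last by rewrite invr_eq0 qpoch_den1_neq0.
apply: qpoch_neq0 => j ji; rewrite qpowRnat qpowR_eq1 subr_eq0 eqr_nat.
by rewrite neq_ltn ji.
Qed.

(** * X and Y applied to phi_k at grid points *)

Let den_shift i k :
  (1 - q `^ (alpha - i%:R)) * qpoch q (q `^ (alpha + 1 - i%:R)) k =
  qpoch q (q `^ (alpha - i%:R)) k * (1 - q ^+ k * q `^ (alpha - i%:R)).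
Proof.
by rewrite -qpoch_shift addrAC [q `^ (_ + 1)]qpowRD (powRr1 (ltW q_gt0))
  [q * _]mulrC.
Qed.

Let num_shift i k :
  (1 - q `^ (- i%:R)) * qpoch q (q `^ (1 - i%:R)) k =
  qpoch q (q `^ (- i%:R)) k * (1 - q ^+ k * q `^ (- i%:R)).
Proof. by rewrite -qpoch_shift [q `^ (1 - _)]qpowRD (powRr1 (ltW q_gt0)). Qed.

Let den_factor_neq0 i k : (k <= i)%N -> (i <= N)%N ->
  1 - q ^+ k * q `^ (alpha - i%:R) != 0.
Proof.
move=> ki iN; have := qpoch_den_neq0 i k.+1 ki iN.
by rewrite qpochS mulf_eq0 negb_or => /andP[].
Qed.

(** With s = q^-i, the shift x -> x - 1 replaces s by q s; [num_shift] and [den_shift] bring the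
    shifted symbols back, and a rational identity in s, q^alpha and q^k remains. For i < k both
    sides vanish. *)
Lemma qphi_X i k : (i <= N)%N ->
  qnum q (i%:R - alpha) * qphi alpha k i%:R
    - q `^ (- alpha) * qnum q i%:R * qphi alpha k (i%:R - 1)
  = q ^+ k * (1 - q `^ (- alpha)) / (1 - q) * qphi (alpha + 1) k i%:R.
Proof.
move=> iN; case: (ltnP i k) => ik.
  rewrite !qphi_grid0 // !mulr0 sub0r; case: i => [|i] in iN ik *.
    by rewrite qnum0 mulr0 mul0r oppr0.
  by rewrite -[i.+1%:R]natr1 addrK qphi_grid0 ?mulr0 ?oppr0 //; lia.
rewrite /qphi /qnum.
have e1 : - (i%:R - 1) = 1 - i%:R :> R by ring.
have e2 : alpha - (i%:R - 1) = alpha + 1 - i%:R by ring.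
rewrite e2 e1.
have hn := num_shift i k; have hd := den_shift i k.
have h0 := den_factor_neq0 i k ik iN.
have h1 := den_factor_neq0 i 0 (leq0n _) iN.
have h2 := qpoch_den_neq0 i k (leqW ik) iN.
have eA : q `^ (i%:R - alpha) = (q `^ (- i%:R))^-1 / q `^ alpha.
  by rewrite qpowRD !powRN invrK.
have es : q `^ i%:R = (q `^ (- i%:R))^-1 by rewrite powRN invrK.
have esA : q `^ (alpha - i%:R) = q `^ alpha * q `^ (- i%:R) by rewrite qpowRD.
have s0 := qpowR_neq0 (- i%:R); have A0 := qpowR_neq0 alpha.
rewrite expr0 mul1r in h1.
rewrite eA es (powRN q alpha).
rewrite [q `^ (alpha - _)]esA in hd h0 h1 h2 *.
set s := q `^ (- i%:R) in hn hd h0 h1 h2 s0 *.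
set A := q `^ alpha in hd h0 h1 h2 A0 *.
set r' := qpoch q (q `^ (alpha + 1 - _)) k in hd *.
set r := qpoch q (A * s) k in hd h2 *.
set p' := qpoch q (q `^ (1 - _)) k in hn *.
set p := qpoch q s k in hn *.
set K := q ^+ k in hn hd h0 *.
have -> : r' = r * (1 - K * (A * s)) / (1 - A * s) by rewrite -hd; field.
(* The product (1 - s) p' is isolated because [hn] determines it, but not p' itself when i = 0 and s
   = 1. *)
transitivity ((1 - s^-1 / A) / (1 - q) * (p / r) + A^-1 / (1 - q) / s
  * ((1 - s) * p') / (r * (1 - K * (A * s)) / (1 - A * s))).
  by field; rewrite ?q1_neq0 ?A0 ?s0 ?h0 ?h1 ?h2.
rewrite hn; field.
by rewrite ?q1_neq0 ?A0 ?s0 ?h0 ?h1 ?h2.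
Qed.

(** All values reduce to p / r times rational functions, as in [qphi_X]; the splits at i = N and k =
    i treat denominators that may vanish. *)
Lemma qphi_Y i k : (i <= N)%N ->
  A1 q alpha beta N i%:R * qphi alpha k.+1 (i%:R + 1)
    + A2 q alpha beta N i%:R * qphi alpha k.+1 (i%:R - 1)
    + A0 q alpha beta N i%:R * qphi alpha k.+1 i%:R
  = qHahn_lambda k.+1 beta N q
      * (q ^+ k.+1 * (1 - q `^ (- alpha)) / (1 - q)
           * qphi (alpha + 1) k.+1 i%:R)
    + qHahn_nu k
      * (q ^+ k * (1 - q `^ (- alpha)) / (1 - q) * qphi (alpha + 1) k i%:R).
Proof.
move=> iN; case: (ltnP i k) => ik.
  have e : i%:R + 1 = i.+1%:R :> R by rewrite natr1.
  rewrite e !qphi_grid0 ?ltnS // 1?ltnW // !mulr0 add0r !addr0.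
  case: i => [|i] in iN ik e *.
    by rewrite /A2 qnum0 mulr0 !mul0r.
  by rewrite -[i.+1%:R]natr1 addrK qphi_grid0 ?mulr0 //; lia.
set s := q `^ (- i%:R); set A := q `^ alpha; set b := q `^ beta.
set M := q ^+ N; set K := q ^+ k.
set p := qpoch q s k; set r := qpoch q (A * s) k.
have s0 : s != 0 := qpowR_neq0 _; have A0' : A != 0 := qpowR_neq0 _.
have M0 : M != 0 := qpow_neq0 _; have K0 : K != 0 := qpow_neq0 _.
have es : q `^ i%:R = s^-1 by rewrite /s powRN invrK.
have esA : q `^ (alpha - i%:R) = A * s by rewrite qpowRD.
have q1e : q `^ 1 = q := powRr1 (ltW q_gt0).
have hn := num_shift i k.+1; have hd := den_shift i k.+1.
have hd' := den_shift i k.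
have h0 := den_factor_neq0 i k ik iN.
have h1 := den_factor_neq0 i 0 (leq0n _) iN.
have h2 := qpoch_den_neq0 i k (leqW ik) iN.
rewrite expr0 mul1r in h1; rewrite !esA in hd hd' h0 h1 h2.
rewrite -/s in hn; rewrite -/r -/K in hd' h0 h2.
have r'e : qpoch q (q `^ (alpha + 1 - i%:R)) k =
    r * (1 - K * (A * s)) / (1 - A * s).
  by rewrite -hd'; field.
have exN : q `^ (i%:R - N%:R) = (s * M)^-1.
  by rewrite qpowRD powRN es qpown invfM.
have ebx : q `^ (beta - i%:R) = b * s by rewrite qpowRD.
have exa1 : q `^ (i%:R + 1 - alpha) = q / (s * A).
  by rewrite !qpowRD powRN q1e es invfM; ring.
have exa : q `^ (i%:R - alpha) = (s * A)^-1 by rewrite !qpowRD powRN es invfM.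
have D1 : A1 q alpha beta N i%:R * qphi alpha k.+1 (i%:R + 1) =
    b * (s * M - 1) / M * (- q) * (s * A - 1) / (s ^+ 2 * A ^+ 2) / (1 - q) ^+ 3
      * (1 - s / q) * (p / r).
  rewrite /A1 /qphi /qnum exN.
  (* For alpha = N + 1 the denominator of phi_(k+1) vanishes at N + 1, but the coefficient A_1(N) is
     0. *)
  have [iN'|ltiN] := eqVneq i N.
    have -> : s * M = 1 by rewrite /s powRN qpown iN' mulVf.
    by rewrite invr1 !subrr; ring.
  rewrite ebx exa1 exa.
  have -> : q `^ (- (i%:R + 1)) = s / q.
    by rewrite opprD qpowRD [q `^ (- 1)]powRN q1e.
  have e : q `^ (alpha - (i%:R + 1)) = (A * s) / q.
    by rewrite opprD addrA qpowRD [q `^ (- 1)]powRN q1e esA.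
  have h3 : 1 - A * s / q != 0.
    rewrite -e subr_eq0 eq_sym qpowR_eq1 natr1 subr_eq0.
    by apply: halpha; lia.
  have h4 : q - A * s != 0.
    have e4 : 1 - A * s / q = (q - A * s) / q by field.
    by move: h3; rewrite e4 mulf_eq0 negb_or => /andP[].
  rewrite e !qpochSl.
  have -> : q * (s / q) = s by field.
  have -> : q * (A * s / q) = A * s by field.
  rewrite -/p -/r; field.
  by rewrite q1_neq0 q_neq0 M0 s0 A0' h2 h4.
have a2 : A2 q alpha beta N i%:R =
    (s - 1) * (s * M * A - b) / (s * M * A) * (s * A - 1) / (s * A)
      / (1 - q) ^+ 3.
  rewrite /A2 /qnum es -/s.
  have -> : q `^ (i%:R - N%:R - alpha + beta) = b / (s * M * A).
    by rewrite 3!qpowRD !powRN es qpown !invfM -/A -/b -/M; ring.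
  by rewrite exa; field; rewrite q1_neq0 M0 s0 A0'.
have a1 : A1 q alpha beta N i%:R =
    b * (s * M - 1) / M * (s * A - q) * (s * A - 1) / (s * A) ^+ 2
      / (1 - q) ^+ 3.
  by rewrite /A1 /qnum exN ebx exa1 exa; field; rewrite q1_neq0 M0 s0 A0'.
rewrite D1 /A0 a1 a2 /qHahn_lambda /qHahn_nu /qnum -/A -/b -/M -/K.
have -> : q `^ (- k.+1%:R) = (q * K)^-1 by rewrite powRN qpown exprS.
have -> : q `^ (k.+1%:R + beta - N%:R) = q * K * b / M.
  by rewrite !qpowRD powRN !qpown exprS.
rewrite /qphi (powRN q alpha) -/A r'e -/s esA -/p.
rewrite -/s.
have -> : alpha - (i%:R - 1) = alpha + 1 - i%:R by ring.
have -> : - (i%:R - 1) = 1 - i%:R :> R by ring.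
rewrite (qpochS _ s) (qpochS _ (A * s)) -/p -/r (exprS q k) -/K.
rewrite (qpochS _ s) (qpochS _ (A * s)) -/p -/r (exprS q k) -/K in hn hd.
set p' := qpoch q (q `^ (1 - _)) _ in hn *.
set r'' := qpoch q _ k.+1 in hd *.
have -> : (s - 1) * (s * M * A - b) / (s * M * A) * (s * A - 1) / (s * A)
    / (1 - q) ^+ 3 * (p' / r'') =
    (s * M * A - b) / (s * M * A) * (s * A - 1) / (s * A) / (1 - q) ^+ 3
      * (((s - 1) * p') / r'') by ring.
have -> : (s - 1) * p' = - (p * (1 - K * s) * (1 - q * K * s)).
  by rewrite -hn; ring.
(* At k = i the factor 1 - q^(alpha+1) of [r''] may be 0; there the terms over [r''] vanish through
   the numerator factor 1 - K s = 0. *)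
case: (ltnP k i) => [ki|ki].
  have h5 := den_factor_neq0 i k.+1 ki iN; rewrite esA exprS -/K in h5.
  have -> : r'' = r * (1 - K * (A * s)) * (1 - q * K * (A * s)) / (1 - A * s).
    by rewrite -hd; field.
  field.
  by rewrite ?q1_neq0 ?q_neq0 ?M0 ?s0 ?A0' ?h0 ?h1 ?h2 ?h5 ?K0.
have {ki} eKs : s = K^-1.
  have -> : K = q ^+ i by congr (q ^+ _); lia.
  by rewrite /s powRN qpown.
have e1 : 1 - K * s = 0 by rewrite eKs divff // subrr.
rewrite e1 !(mulr0, mul0r, oppr0, addr0, add0r).
move: h0 h1 s0; rewrite eKs => h0 h1 s0.
have h3 : 1 - A != 0 by rewrite mulrCA divff // mulr1 in h0.
have h4 : K - A != 0.
  have e2 : 1 - A / K = (K - A) / K by field.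
  by move: h1; rewrite e2 mulf_eq0 negb_or => /andP[].
by field; rewrite K0 h4 h3 h2 q1_neq0 A0' M0 q_neq0.
Qed.

(** * The operators as linear maps on M_N *)

Lemma ext0_nat f (i : 'I_N.+1) : ext0 f (i : nat)%:Z = f i.
Proof. by rewrite /ext0 (big_pred1 i). Qed.

(** At i = 0 the extension by 0 and F(-1) may differ, but both are multiplied by [0]_q = 0. *)
Lemma opX_grid (F : R -> R) (i : 'I_N.+1) :
  opX q alpha (restrict_grid N F) i =
  qnum q ((i : nat)%:R - alpha) * F (i : nat)%:R
    - q `^ (- alpha) * qnum q (i : nat)%:R * F ((i : nat)%:R - 1).
Proof.
rewrite !ffunE; congr (_ - _).
case: i => [[|i] hi] /=; first by rewrite qnum0 !(mul0r, mulr0).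
have -> : i.+1%:Z - 1 = (Ordinal (ltnW hi) : nat)%:Z by rewrite /=; lia.
by rewrite ext0_nat ffunE /= -natr1 addrK.
Qed.

Lemma opY_grid (F : R -> R) (i : 'I_N.+1) :
  opY q alpha beta (restrict_grid N F) i =
  A1 q alpha beta N (i : nat)%:R * F ((i : nat)%:R + 1)
    + A2 q alpha beta N (i : nat)%:R * F ((i : nat)%:R - 1)
    + A0 q alpha beta N (i : nat)%:R * F (i : nat)%:R.
Proof.
rewrite !ffunE; congr (_ + _ + _).
  have [iN|iN] := eqVneq (i : nat) N.
    by rewrite iN /A1 subrr qnum0 mulr0 !mul0r.
  have hi : (i.+1 < N.+1)%N by have := ltn_ord i; lia.
  have -> : (i : nat)%:Z + 1 = (Ordinal hi : nat)%:Z by rewrite /=; lia.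
  by rewrite ext0_nat ffunE /= natr1.
case: i => [[|i] hi] /=.
  by rewrite /A2 qnum0 mulr0 !mul0r.
have -> : i.+1%:Z - 1 = (Ordinal (ltnW hi) : nat)%:Z by rewrite /=; lia.
by rewrite ext0_nat ffunE /= -natr1 addrK.
Qed.

Lemma ext0_linear (c : R) f g y : ext0 (c *: f + g) y = c * ext0 f y + ext0 g y.
Proof.
rewrite /ext0 mulr_sumr -big_split /=.
by apply: eq_bigr => i _; rewrite !ffunE.
Qed.

Lemma opX_linear : linear (@opX R q alpha N).
Proof.
move=> c f g; apply/ffunP => i.
by rewrite !ffunE !ext0_linear /GRing.scale /=; ring.
Qed.

Lemma opY_linear : linear (@opY R q alpha beta N).
Proof.
move=> c f g; apply/ffunP => i.
by rewrite !ffunE !ext0_linear /GRing.scale /=; ring.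
Qed.

HB.instance Definition _ :=
  GRing.isLinear.Build R {ffun 'I_N.+1 -> R} {ffun 'I_N.+1 -> R} _ _ opX_linear.
HB.instance Definition _ :=
  GRing.isLinear.Build R {ffun 'I_N.+1 -> R} {ffun 'I_N.+1 -> R} _ _ opY_linear.

(** * The bidiagonal pencil *)

Notation phi k := (restrict_grid N (qphi alpha k)).
Notation psi k := (restrict_grid N (qphi (alpha + 1) k)).
Notation lam k := (qHahn_lambda k beta N q).

Lemma opX_phi k :
  opX q alpha (phi k) = (q ^+ k * (1 - q `^ (- alpha)) / (1 - q)) *: psi k.
Proof.
apply/ffunP => i; rewrite opX_grid qphi_X; last by rewrite -ltnS.
by rewrite !ffunE.
Qed.

Lemma opY_phi0 : opY q alpha beta (phi 0) = 0.
Proof.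
apply/ffunP => i; rewrite opY_grid /qphi !qpoch0 !ffunE divff ?oner_neq0 //.
by rewrite /A0 !mulr1 subrr.
Qed.

Lemma opY_phiS k : opY q alpha beta (phi k.+1) =
  lam k.+1 *: opX q alpha (phi k.+1) + qHahn_nu k *: opX q alpha (phi k).
Proof.
rewrite !opX_phi; apply/ffunP => i.
rewrite opY_grid qphi_Y; last by rewrite -ltnS.
by rewrite !ffunE.
Qed.

Lemma qHahn_nuN : qHahn_nu N = 0.
Proof. by rewrite /qHahn_nu divff // subrr mulr0 !mul0r. Qed.

Lemma qHahn_nu_neq0 k : (k < N)%N -> qHahn_nu k != 0.
Proof.
move=> kN; rewrite /qHahn_nu !mulf_neq0 ?invr_eq0 ?expf_neq0 ?qpow_sub1_neq0 //.
  by rewrite mulf_neq0.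
(* 1 - q^k / q^N is brought to the form (q^(N-k) - 1) / q^(N-k). *)
rewrite -[in q ^+ N](subnKC (ltnW kN)) exprD invfM mulrA divff // mul1r.
rewrite -[X in X - _](divff (qpow_neq0 (N - k))) -[X in _ - X]mul1r -mulrBl.
rewrite mulf_neq0 ?invr_eq0 // -opprB oppr_eq0 qpow_sub1_neq0 //; lia.
Qed.

Lemma qHahn_lambda0 : lam 0 = 0.
Proof. by rewrite /qHahn_lambda oppr0 qnum0 mul0r. Qed.

(** phi_(k+1) contributes nu_k to X phi_k. At k = N the entry [g N.+1] appears with coefficient nu_N
    = 0. *)
Lemma opY_comb (g : nat -> R) :
  opY q alpha beta (\sum_(k < N.+1) g k *: phi k) =
  \sum_(k < N.+1) (g k * lam k + g k.+1 * qHahn_nu k) *: opX q alpha (phi k).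
Proof.
under [RHS]eq_bigr do rewrite scalerDl.
rewrite big_split /= [X in _ = _ + X]big_ord_recr /= qHahn_nuN mulr0.
rewrite scale0r addr0.
rewrite [LHS]linear_sum [LHS]big_ord_recl [in RHS]big_ord_recl /=.
rewrite [X in X + _ = _]linearZ /= opY_phi0.
rewrite qHahn_lambda0 mulr0 scaler0 scale0r !add0r -big_split /=.
apply: eq_bigr => k _.
by rewrite linearZ /= /bump leq0n add1n opY_phiS scalerDr !scalerA.
Qed.

(** * The coefficients of U_n in the basis phi_k *)

Definition qHahn_norm n : R :=
  qpoch q (q `^ (- N%:R)) n / qpoch q (q `^ (- n%:R - beta)) n.

Definition qHahn_coef n k : R :=
  qpoch q (q `^ (- n%:R)) k * qpoch q (q `^ (n%:R + beta - N%:R)) k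
    / (qpoch q q k * qpoch q (q `^ (- N%:R)) k) * (q `^ (alpha - beta)) ^+ k.

Lemma qHahnU_comb n x : qHahnU n x alpha beta N q =
  qHahn_norm n * \sum_(k < n.+1) qHahn_coef n k * qphi alpha k x.
Proof.
congr (_ * _); apply: eq_bigr => k _.
by rewrite !big_cons !big_nil !mulr1 /qHahn_coef /qphi !invfM; ring.
Qed.

Lemma qHahn_coef_eq0 n k : (n < k)%N -> qHahn_coef n k = 0.
Proof. by move=> nk; rewrite /qHahn_coef qpoch_grid0 // !mul0r. Qed.

Lemma qpochN_factor_neq0 k : (k < N)%N -> 1 - q ^+ k * q `^ (- N%:R) != 0.
Proof.
move=> kN; rewrite subr_eq0 eq_sym qpowRnat qpowR_eq1 subr_eq0 eqr_nat.
by rewrite neq_ltn kN.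
Qed.

(** lam n - lam k = q^-k (1 - q^(k-n)) (1 - q^(k+n+beta-N)) / (1 - q)^2, and the two brackets are
    the numerator factors gained from k to k + 1. *)
Lemma qHahn_coefS n k : (k < N)%N ->
  qHahn_coef n k.+1 * qHahn_nu k = qHahn_coef n k * (lam n - lam k).
Proof.
move=> kN; have h1 := qpochN_factor_neq0 k kN.
have h2 := qpow_sub1_neq0 k.+1 isT.
rewrite /qHahn_coef !qpochS exprSr.
have h3 : qpoch q q k != 0.
  by apply: qpoch_neq0 => i _; rewrite -exprSr qpow_eq1.
have h4 : qpoch q (q `^ (- N%:R)) k != 0.
  apply: qpoch_neq0 => i ik; have := qpochN_factor_neq0 i (ltn_trans ik kN).
  by rewrite subr_eq0 eq_sym.
rewrite /qHahn_nu /qHahn_lambda /qnum.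
rewrite !qpowRD !powRN !qpown in h1 h4 *.
rewrite !exprSr in h2 *.
set K := q ^+ k in h1 h2 *; set r := qpoch q _ k in h4 *.
set u := qpoch q _ k; set v := qpoch q _ k; set w := qpoch q _ k in h3 *.
have A0 := qpowR_neq0 alpha; have b0 := qpowR_neq0 beta.
have M0 := qpow_neq0 N; have K0 : K != 0 := qpow_neq0 k.
have n0 := qpow_neq0 n.
have h5 : q ^+ N - K != 0.
  have e : 1 - K / q ^+ N = (q ^+ N - K) / q ^+ N by field.
  by move: h1; rewrite e mulf_eq0 negb_or => /andP[].
by field; rewrite h2 h3 h4 h5 A0 b0 M0 K0 n0 q1_neq0.
Qed.

Lemma qHahn_coef0 n : qHahn_coef n 0 = 1.
Proof. by rewrite /qHahn_coef !qpoch0 expr0 !mulr1 divr1. Qed.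

Lemma qHahnU_grid n : (n <= N)%N ->
  restrict_grid N (fun x => qHahnU n x alpha beta N q) =
  qHahn_norm n *: \sum_(k < N.+1) qHahn_coef n k *: phi k.
Proof.
move=> nN; apply/ffunP => i; rewrite !ffunE qHahnU_comb sum_ffunE.
congr (_ * _).
(* The sum up to n is padded to N by coefficients that are 0. *)
rewrite (big_ord_widen N.+1 (fun k => qHahn_coef n k * qphi alpha k i%:R)) //.
rewrite [RHS](bigID (fun k : 'I__ => (k < n.+1)%N)) /=.
rewrite [X in _ = _ + X]big1 ?addr0 => [|k]; last first.
  by rewrite -leqNgt => nk; rewrite !ffunE qHahn_coef_eq0 // scale0r.
by apply: eq_bigr => k _; rewrite !ffunE.
Qed.

(** Coefficients of X phi_k are compared. At k = N, nu_N = 0 and either n = N or the coefficient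
    itself is 0. *)
Lemma qHahn_eigen n : (n <= N)%N ->
  opY q alpha beta (\sum_(k < N.+1) qHahn_coef n k *: phi k) =
  lam n *: opX q alpha (\sum_(k < N.+1) qHahn_coef n k *: phi k).
Proof.
move=> nN; rewrite opY_comb linear_sum scaler_sumr; apply: eq_bigr => k _.
rewrite linearZ scalerA /=; congr (_ *: _).
have [kN|Nk] := ltnP k N; first by rewrite qHahn_coefS //; ring.
have -> : k = N :> nat by have := ltn_ord k; lia.
rewrite qHahn_nuN mulr0 addr0.
have [->|nN'] := eqVneq n N; first exact: mulrC.
by rewrite qHahn_coef_eq0 ?mul0r ?mulr0 // ltn_neqAle nN'.
Qed.

(** * Independence of the X phi_k and uniqueness of the solutions *)

Lemma opX_free (g : nat -> R) :
  \sum_(k < N.+1) g k *: opX q alpha (phi k) = 0 ->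
  forall k, (k <= N)%N -> g k = 0.
Proof.
pose s k := q ^+ k * (1 - q `^ (- alpha)) / (1 - q).
move=> g0 k kN.
have s0 : s k != 0.
  rewrite mulf_neq0 ?invr_eq0 // mulf_neq0 // subr_eq0 eq_sym qpowR_eq1.
  rewrite oppr_eq0.
  exact: (halpha 0).
apply: (mulIf s0); rewrite mul0r.
apply: (triangular_free N (qphi (alpha + 1)) _ _ (fun k => g k * s k)) => //.
- by move=> i j; exact: qphi_grid0.
- exact: qphi1_diag_neq0.
by rewrite -[RHS]g0; apply: eq_bigr => j _; rewrite opX_phi scalerA.
Qed.

Lemma qHahn_eigen_unique (l : R) f : f != 0 ->
  opY q alpha beta f = l *: opX q alpha f ->
  exists2 n, (n <= N)%N & l = lam n /\
    exists c : R, f = c *: \sum_(k < N.+1) qHahn_coef n k *: phi k.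
Proof.
have [g ->] := triangular_span N (qphi alpha) (fun i k => @qphi_grid0 alpha i k)
  qphi_diag_neq0 f.
move=> f0; rewrite opY_comb linear_sum /= scaler_sumr => /eqP.
rewrite -subr_eq0 -sumrB => /eqP e.
have rec k : (k <= N)%N -> g k * (lam k - l) + g k.+1 * qHahn_nu k = 0.
  apply: (opX_free (fun k => g k * (lam k - l) + g k.+1 * qHahn_nu k)).
  rewrite -[RHS]e; apply: eq_bigr => j _.
  rewrite [opX q alpha (g j *: _)]linearZ /= scalerA -scalerBl.
  by congr (_ *: _); ring.
(* If l = lam n, [rec] is the recursion of [qHahn_coef n] and determines g upwards from g 0, as nu_j
   is nonzero for j < N. Otherwise it forces g k = 0 downwards from k = N. *)
have [/existsP[n /eqP ln]|/existsPn ln] :=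
    boolP [exists n : 'I_N.+1, l == lam n].
  exists n; first by rewrite -ltnS.
  split=> //; exists (g 0%N); rewrite scaler_sumr; apply: eq_bigr => k _.
  rewrite scalerA; congr (_ *: _).
  have : (k <= N)%N by rewrite -ltnS.
  elim: (k : nat) => [|j IH] jN; first by rewrite qHahn_coef0 mulr1.
  apply: (mulIf (qHahn_nu_neq0 j jN)); rewrite -mulrA qHahn_coefS //.
  rewrite [RHS]mulrA -(IH (ltnW jN)) -ln.
  apply/eqP; rewrite -subr_eq0; apply/eqP.
  by rewrite -[RHS](rec j (ltnW jN)); ring.
exfalso; move/eqP: f0; apply; apply: big1 => k _.
suff -> : g k = 0 by rewrite scale0r.
have gN j : (j <= N)%N -> g j.+1 * qHahn_nu j = 0 -> g j = 0.
  move=> jN h; have := rec j jN; rewrite h addr0 => /eqP.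
  rewrite mulf_eq0 subr_eq0 => /orP[/eqP//|/eqP lj].
  by have := ln (Ordinal (jN : (j < N.+1)%N)); rewrite /= lj eqxx.
have : (k <= N)%N by rewrite -ltnS.
(* Downward induction on k, run as induction on N - k. *)
rewrite -(subKn (n := N) (m := k)) ?leq_subr; last by rewrite -ltnS.
elim: (N - k)%N => [|j IH] jN.
  by rewrite subn0; apply: gN => //; rewrite qHahn_nuN mulr0.
have [jlt|jge] := ltnP j N.
  apply: gN; first by rewrite leq_subr.
  by rewrite -subSn // subSS IH ?mul0r // leq_subr.
have e1 : (N - j.+1 = N - j)%N by lia.
by rewrite e1 IH // leq_subr.
Qed.

(** * Nonvanishing of the normalizing constant and of U_n *)

Context (hbeta : forall j : nat, (0 < j <= N)%N -> beta != - j%:R).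

(** A zero of the denominator would give beta = -(n - i) with 0 < n - i <= N, against [hbeta]. *)
Lemma qHahn_norm_neq0 n : (n <= N)%N -> qHahn_norm n != 0.
Proof.
move=> nN; apply: mulf_neq0; rewrite ?invr_eq0; apply: qpoch_neq0 => i i_n.
  by rewrite -subr_eq0 -opprB oppr_eq0 qpochN_factor_neq0 //; lia.
rewrite qpowRnat qpowR_eq1.
have := hbeta (n - i)%N; rewrite natrB ?(ltnW i_n) // => /(_ ltac:(lia)).
by apply: contra_neq => e; lra.
Qed.

Lemma qHahn_comb_neq0 n :
  \sum_(k < N.+1) qHahn_coef n k *: phi k != 0.
Proof.
apply/negP => /eqP e.
have := triangular_free N (qphi alpha) (fun i k => @qphi_grid0 alpha i k)
  qphi_diag_neq0 (qHahn_coef n) e 0 (leq0n _).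
by move/eqP; rewrite qHahn_coef0 oner_eq0.
Qed.

(** * Limits along any filter on which q^x tends to 0 *)

Section Limit.
Context (F : set_system R) (FF : ProperFilter F).
Context (qF : q `^ x @[x --> F] --> (0 : R)).

Lemma qphi_cvg k : qphi alpha k x @[x --> F] --> (q `^ (- alpha)) ^+ k.
Proof.
elim: k => [|k IH].
  rewrite expr0 (_ : (fun x => _) = fun=> 1); first exact: cvg_cst.
  by apply/funext => x; rewrite /qphi !qpoch0 divr1.
(* Both parts of the new factor are multiplied by q^x, so that each has a finite limit. *)
have -> : qphi alpha k.+1 = fun x => qphi alpha k x
    * ((q `^ x - q ^+ k) / (q `^ x - q ^+ k * q `^ alpha)).
  apply/funext => x; rewrite /qphi !qpochS !invfM mulrACA; congr (_ * _).
  have x0 := qpowR_neq0 x.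
  have -> : q `^ x - q ^+ k = (1 - q ^+ k * q `^ (- x)) * q `^ x.
    by rewrite powRN; field.
  have -> : q `^ x - q ^+ k * q `^ alpha =
      (1 - q ^+ k * q `^ (alpha - x)) * q `^ x.
    by rewrite qpowRD powRN; field.
  by rewrite invfM mulrACA divff // mulr1.
rewrite exprSr; apply: cvgM => //.
have -> : q `^ (- alpha) = (0 - q ^+ k) / (0 - q ^+ k * q `^ alpha).
  by rewrite powRN; field; rewrite qpowR_neq0 qpow_neq0.
apply: cvgM; first by apply: cvgB => //; exact: cvg_cst.
apply: cvgV; first by rewrite sub0r oppr_eq0 mulf_neq0.
by apply: cvgB => //; exact: cvg_cst.
Qed.

Lemma qHahnU_cvg n : (n <= N)%N ->
  qHahnU n x alpha beta N q @[x --> F] --> (1 : R).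
Proof.
move=> nN.
rewrite (_ : (fun x => _) = fun x =>
  qHahn_norm n * \sum_(k < n.+1) qHahn_coef n k * qphi alpha k x); last first.
  by apply/funext => x; exact: qHahnU_comb.
rewrite [X in _ --> X](_ : _ = qHahn_norm n
    * \sum_(k < n.+1) qHahn_coef n k * (q `^ (- alpha)) ^+ k).
  apply: cvgM; first exact: cvg_cst.
  apply: cvg_big => [|k _]; first exact: add_continuous.
  by apply: cvgM; [exact: cvg_cst | exact: qphi_cvg].
(* The limit series is 2phi1(q^-n, B; C; q; q^-beta), with q^-beta = C q^n / B and C / B =
   q^(-n-beta), so its sum is the inverse of [qHahn_norm n]. *)
pose B := q `^ (n%:R + beta - N%:R); pose C := q `^ (- N%:R).
have B0 : B != 0 := qpowR_neq0 _.
have BE : C * q ^+ n / B = q `^ (alpha - beta) * q `^ (- alpha).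
  rewrite -qpown -!qpowRD -powRN -qpowRD; congr (q `^ _); ring.
have := @qChu_Vandermonde R q B C n q_neq0 B0.
have -> : qhyp n [:: q ^- n; B] [:: C] q (C * q ^+ n / B) =
    \sum_(k < n.+1) qHahn_coef n k * (q `^ (- alpha)) ^+ k.
  apply: eq_bigr => k _; rewrite !big_cons !big_nil !mulr1 /qHahn_coef.
  by rewrite BE exprMn -qpown -powRN /B /C; ring.
have -> : C / B = q `^ (- n%:R - beta).
  by rewrite -powRN -qpowRD; congr (q `^ _); ring.
move=> ->; last first.
  move=> k kn; rewrite qpow_sub1_neq0 // qpochN_factor_neq0 //.
  exact: leq_trans kn nN.
have := qHahn_norm_neq0 n nN; rewrite /qHahn_norm -/C.
rewrite mulf_eq0 invr_eq0 negb_or => /andP[h1 h2].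
by field; rewrite h1 h2.
Qed.

End Limit.

End Grid.

(** * The limit directions and the assembled theorem *)

Lemma powR_cvgy_0 {R : realType} (q : R) : 0 < q -> q < 1 ->
  q `^ x @[x --> +oo] --> (0 : R).
Proof.
move=> q0 q1.
have l0 : 0 < - ln q by rewrite oppr_gt0 ln_lt0 // q0.
rewrite (_ : (fun x => _) = (fun y => expR (- y)) \o (fun x => - ln q * x)).
  apply: cvg_comp; last exact: cvgr_expR.
  by apply: gt0_cvgMry => //; exact: cvg_id.
apply/funext => x /=; rewrite /powR gt_eqF //; congr expR; ring.
Qed.

Theorem proposition1 (R : realType) (N : nat) (q alpha beta : R)
  (q_gt0 : 0 < q) (q_neq1 : q != 1)
  (* X is invertible *)
  (halpha : forall j : nat, (j <= N)%N -> alpha != j%:R)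
  (* the denominators (q^{-n-beta};q)_n, n <= N, do not vanish *)
  (hbeta : forall j : nat, (0 < j <= N)%N -> beta != - j%:R) :
  let U (n : nat) (x : R) : R := qHahnU n x alpha beta N q in
  let UN (n : nat) : {ffun 'I_N.+1 -> R} := restrict_grid N (U n) in
  let lambda (n : nat) : R := qHahn_lambda n beta N q in
  [/\ (* each U_n is a nonzero solution, with eigenvalue lambda_n *)
      forall n : nat, (n <= N)%N ->
        UN n != 0 /\
        opY q alpha beta (UN n) = lambda n *: opX q alpha (UN n),
      (* there are no other eigenvalues, nor other solutions up to a factor *)
      forall (l : R) (f : {ffun 'I_N.+1 -> R}), f != 0 ->
        opY q alpha beta f = l *: opX q alpha f ->
        exists2 n : nat, (n <= N)%N &
          l = lambda n /\ exists c : R, f = c *: UN n,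
      (* normalization *)
      q < 1 -> forall n : nat, (n <= N)%N -> U n x @[x --> +oo] --> (1 : R)
    & (* for q > 1 the point q^x = 0 is reached in the opposite direction *)
      1 < q -> forall n : nat, (n <= N)%N -> U n x @[x --> -oo] --> (1 : R)].
Proof.
move=> U UN lambda.
have norm0 n : (n <= N)%N -> qHahn_norm N q beta n != 0.
  exact: qHahn_norm_neq0.
split.
- move=> n nN; rewrite /UN /U qHahnU_grid //; split.
    by rewrite scaler_eq0 negb_or norm0 // qHahn_comb_neq0.
  by rewrite !linearZ /= qHahn_eigen // !scalerA mulrC.
- move=> l f f0 ef.
  have [n nN [-> [c ->]]] :=
    qHahn_eigen_unique N q alpha beta q_gt0 q_neq1 halpha l f f0 ef.
  exists n => //; split=> //.
  (* c refers to the sum without its normalizing factor. *)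
  exists (c / qHahn_norm N q beta n).
  by rewrite /UN /U qHahnU_grid // scalerA divfK // norm0.
- by move=> q1 n nN; apply: qHahnU_cvg => //; exact: powR_cvgy_0.
- move=> q1 n nN; apply: qHahnU_cvg => //.
  (* The substitution x -> -x replaces q > 1 by the base q^-1 < 1. *)
  apply/cvgNy_compNP.
  have -> : (fun x => q `^ x) \o -%R = fun x => q^-1 `^ x.
    apply/funext => x /=.
    rewrite /powR invr_eq0 gt_eqF // lnV ?posrE //; congr expR; ring.
  by apply: powR_cvgy_0; rewrite ?invr_gt0 ?invf_lt1.
Qed.
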